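(* Let $m$ be an integer larger than $1$ and $r\in\{0,1,2,\ldots,m\}$. Let $l$ be a positive integer and let $\{A_i\}_{i=1}^m$ $(A_i\in O(l))$ be a family of orthogonal matrices satisfying $A_iA_j+A_jA_i=2\eta_{ij}E_l$ for all $i,j\in\{1,\ldots,m\}$, where $(\eta_{ij})=J_{r,m-r}$. For a positive integer $d$, let $P_i$ $(i=1,\ldots,m)$ be the $2dl\times 2dl$ matrix, viewed as a $2d\times 2d$ array of $l\times l$ blocks, defined as follows: if $i\in\{1,\ldots,r\}$, $P_i$ is the block anti-diagonal matrix all of whose $2d$ anti-diagonal blocks equal $A_i$ (all other blocks zero); if $i\in\{r+1,\ldots,m\}$, $P_i$ is the block diagonal matrix all of whose $2d$ diagonal blocks equal $A_i$. Then $\{P_i\}_{i=1}^m$ is a Clifford system of signature $(m,r)$ on $\mathbb{R}^{2dl}_{dl}$.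
   Context: $O(l)$ is the group of real orthogonal $l\times l$ matrices and $E_l$ the identity matrix. For $0\le s\le n$, $\mathbb{R}^n_s$ denotes $\mathbb{R}^n$ with the pseudo-inner product $\langle u,v\rangle={}^t u\,J_{s,n-s}\,v$, where $J_{i,j}:=(-E_i)\oplus E_j$ is the diagonal matrix with $i$ entries $-1$ followed by $j$ entries $+1$ ($J_{0,j}=E_j$, $J_{i,0}=-E_i$). $\mathrm{Sym}(\mathbb{R}^n_s)$ is the set of linear endomorphisms $Q$ of $\mathbb{R}^n_s$ with $\langle Qu,v\rangle=\langle u,Qv\rangle$ for all $u,v$. A Clifford system of signature $(m,r)$ on $\mathbb{R}^{2k}_s$ ($k$ a positive integer, $0\le s\le 2k$) is a family $\{P_i\}_{i=1}^m$ with $P_i\in\mathrm{Sym}(\mathbb{R}^{2k}_s)$ and $P_iP_j+P_jP_i=2\eta_{ij}I$ for all $i,j\in\{1,\ldots,m\}$, where $(\eta_{ij})=J_{r,m-r}$ and $I$ is the identity. *)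

(* Defs.v *)
From HB Require Import structures.
From mathcomp Require Import all_boot all_order all_algebra.
From mathcomp Require Import reals.

Set Implicit Arguments.
Unset Strict Implicit.
Unset Printing Implicit Defensive.

Import Order.TTheory GRing.Theory Num.Theory.
Local Open Scope ring_scope.

Section CliffordSystems.
Variable R : realType.

(* [sign_mx n s] is J_{s,n-s} = (-E_s) (+) E_{n-s}, for s <= n. *)
Definition sign_mx (n s : nat) : 'M[R]_n :=
  diag_mx (\row_(i < n) (if (i < s)%N then -1 else 1)).

Definition orthogonal_mx (l : nat) (A : 'M[R]_l) : Prop := A^T *m A = 1%:M.

Definition pseudo_inner (n s : nat) (u v : 'cV[R]_n) : R :=
  (u^T *m sign_mx n s *m v) 0 0.

(* Endomorphisms of R^n_s are identified with the matrices through which they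
   act on column vectors. *)
Definition pseudo_sym (n s : nat) (Q : 'M[R]_n) : Prop :=
  forall u v : 'cV[R]_n, pseudo_inner s (Q *m u) v = pseudo_inner s u (Q *m v).

(* With eta = J_{r,m-r}; indices start at 0, so eta i i = -1 iff i < r. *)
Definition clifford_relations (m r n : nat) (P : 'I_m -> 'M[R]_n) : Prop :=
  forall i j : 'I_m,
    P i *m P j + P j *m P i = (2 * sign_mx m r i j)%:M.

Record clifford_system (m r k s : nat) (P : 'I_m -> 'M[R]_(2 * k)) : Prop :=
  CliffordSystem {
    clifford_r_le : (r <= m)%N;
    clifford_k_gt0 : (0 < k)%N;
    clifford_s_le : (s <= 2 * k)%N;
    clifford_sym : forall i : 'I_m, pseudo_sym s (P i);
    clifford_rel : clifford_relations r P
  }.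

Lemma block_dim (d l : nat) : (\sum_(a < 2 * d) l = 2 * (d * l))%N.
Proof. by rewrite sum_nat_const card_ord mulnA. Qed.

Definition block_diag (d l : nat) (A : 'M[R]_l) : 'M[R]_(2 * (d * l)) :=
  castmx (block_dim d l, block_dim d l) (\mxdiag_(a < 2 * d) A).

Definition block_antidiag (d l : nat) (A : 'M[R]_l) : 'M[R]_(2 * (d * l)) :=
  castmx (block_dim d l, block_dim d l)
    (\mxblock_(a < 2 * d, b < 2 * d) (if b == rev_ord a then A else 0)).

Definition block_family (m r d l : nat) (A : 'I_m -> 'M[R]_l) (i : 'I_m) :
    'M[R]_(2 * (d * l)) :=
  if (i < r)%N then block_antidiag d (A i) else block_diag d (A i).

End CliffordSystems.

Arguments clifford_system {R} m r k s P.

(* Main.v *)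
Require Import Defs.
From HB Require Import structures.
From mathcomp Require Import all_boot all_order all_algebra.
From mathcomp Require Import perm reals.

Set Implicit Arguments.
Unset Strict Implicit.
Unset Printing Implicit Defensive.

Import Order.TTheory GRing.Theory Num.Theory.
Local Open Scope ring_scope.

(** The matrices in play are Kronecker products with a [2d x 2d] left factor.
Let [S] be the antidiagonal permutation matrix and [K = J_{d,d}]. Then
[P_i = S (x) A_i] for [i < r], [P_i = 1 (x) A_i] otherwise, and the metric
[J_{dl,dl}] is [K (x) 1] ([sign_mx_kron]). Write [c_i] for the left factor of
[P_i] and [eps_i] for [eta_ii].

The Clifford relations pass from the [A_i] to the [P_i] because the [c_i]
commute: [P_i P_j + P_j P_i = c_i c_j (x) 2 eta_ij], which vanishes for
[i <> j], while [c_i ^ 2 = 1] settles [i = j].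

Symmetry for the metric means that [P_i^T J = J P_i]. Since [A_i] is orthogonal
with square [eps_i], its transpose is [eps_i A_i]; this sign is absorbed by the
left factors, as [S] anticommutes with [K] and [1] commutes with it:
[c_i K = eps_i K c_i]. *)

Section Kronecker.
Variable R : comPzRingType.

(** The cast is left arbitrary so that it can be eliminated in proofs. *)
Definition kron (N l n : nat) (e : (\sum_(a < N) l = n)%N)
    (c : 'M[R]_N) (A : 'M[R]_l) : 'M[R]_n :=
  castmx (e, e) (\mxblock_(a < N, b < N) (c a b *: A)).

Variables (N l n : nat) (e : (\sum_(a < N) l = n)%N).
Implicit Types (c : 'M[R]_N) (A : 'M[R]_l).

Lemma mul_kron c c' A A' :
  kron e c A *m kron e c' A' = kron e (c *m c') (A *m A').
Proof.
rewrite /kron; case: n / e; rewrite !castmx_id mul_mxblock.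
apply: eq_mxblock => a b; rewrite mxE scaler_suml; apply: eq_bigr => k _.
by rewrite -scalemxAl -scalemxAr scalerA.
Qed.

Lemma tr_kron c A : (kron e c A)^T = kron e c^T A^T.
Proof.
rewrite /kron; case: n / e; rewrite !castmx_id tr_mxblock.
by apply: eq_mxblock => a b; rewrite linearZ mxE.
Qed.

Lemma kronDr c A A' : kron e c (A + A') = kron e c A + kron e c A'.
Proof.
rewrite /kron; case: n / e; rewrite !castmx_id -mxblockD.
by apply: eq_mxblock => a b; rewrite scalerDr.
Qed.

Lemma kronZ a c A : kron e (a *: c) A = kron e c (a *: A).
Proof.
rewrite /kron; case: n / e; rewrite !castmx_id.
by apply: eq_mxblock => i j; rewrite mxE scalerA mulrC.
Qed.

Lemma kron0r c : kron e c 0 = 0.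
Proof.
rewrite /kron; case: n / e; rewrite !castmx_id -[RHS]mxblock0.
by apply: eq_mxblock => a b; rewrite scaler0.
Qed.

Lemma kron1l A : kron e 1%:M A = castmx (e, e) (\mxdiag_(a < N) A).
Proof.
rewrite /kron /mxdiag; congr castmx; apply: eq_mxblock => a b; rewrite mxE.
case: eqVneq => _; last by rewrite scale0r.
by rewrite conform_mx_id scale1r.
Qed.

Lemma kron_scalar a : kron e 1%:M a%:M = a%:M.
Proof. by rewrite kron1l mxdiagZ; case: n / e; rewrite castmx_id. Qed.

End Kronecker.

Section SignMatrix.
Variable R : realType.

Lemma pseudo_symP n s (Q : 'M[R]_n) :
  Q^T *m sign_mx R n s = sign_mx R n s *m Q -> pseudo_sym s Q.
Proof.
by move=> QJ u v; rewrite /pseudo_inner trmx_mul -(mulmxA _ Q^T) QJ !mulmxA.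
Qed.

(** Row [t] of the large matrix lies in the block of index [t / l], so the cut
at [q * l] falls on a block boundary. *)
Lemma sign_mx_kron N l n q (e : (\sum_(a < N) l = n)%N) :
  sign_mx R n (q * l) = kron e (sign_mx R N q) 1%:M.
Proof.
rewrite /kron; case: n / e; rewrite castmx_id.
have lt_block (t : 'I_(\sum_(a < N) l)) :
    (t < q * l)%N = (tagnat.sig1 t < q)%N.
  have lt_l := ltn_ord (tagnat.sig2 t).
  have l_gt0 : (0 < l)%N by apply: leq_ltn_trans lt_l.
  rewrite -ltn_divLR // {1}(tagnat.rect t).
  have -> : (\sum_(i < N | (i < tagnat.sig1 t)%N) l = tagnat.sig1 t * l)%N.
    rewrite -(big_ord_widen _ (fun=> l)) ?(ltnW (ltn_ord _)) //.
    by rewrite sum_nat_const card_ord.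
  by rewrite divnMDl // divn_small ?addn0.
have -> : sign_mx R (\sum_(a < N) l) (q * l) =
    diag_mx (\mxrow_(a < N) const_mx (if (a < q)%N then -1 else 1)).
  by congr diag_mx; apply/rowP => t; rewrite !mxE lt_block.
rewrite diag_mxrow /mxdiag; apply: eq_mxblock => a b.
case: eqVneq => [<-|nab]; last by rewrite !mxE (negbTE nab) scale0r.
by rewrite conform_mx_id diag_const_mx !mxE eqxx scalemx1.
Qed.

Definition rev_mx n : 'M[R]_n := perm_mx (perm (@rev_ord_inj n)).

Lemma tr_rev_mx n : (rev_mx n)^T = rev_mx n.
Proof.
by apply/matrixP => a b; rewrite !mxE !permE -(can_eq rev_ordK) rev_ordK eq_sym.
Qed.

Lemma rev_mxK n : rev_mx n *m rev_mx n = 1%:M.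
Proof.
rewrite -perm_mxM -perm_mx1; congr perm_mx.
by apply/permP => a; rewrite permM !permE rev_ordK.
Qed.

(** Reversal exchanges the two halves of the index range, on which the signs
are opposite. *)
Lemma rev_mx_sign_mx d :
  rev_mx (2 * d) *m sign_mx R (2 * d) d =
  - (sign_mx R (2 * d) d *m rev_mx (2 * d)).
Proof.
rewrite mul_mx_diag mul_diag_mx; apply/matrixP => a b; rewrite !mxE !permE.
case: eqVneq => [<-|_]; last by rewrite mul0r mulr0 oppr0.
rewrite mul1r mulr1 /=.
have -> : (2 * d - a.+1 < d)%N = ~~ (a < d)%N.
  have lt_a := ltn_ord a.
  by rewrite -leqNgt ltn_subLR // [ltnLHS]mul2n -addnn ltn_add2r ltnS.
by case: (a < d)%N; rewrite /= ?opprK.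
Qed.

Lemma block_diagE d l (A : 'M[R]_l) :
  block_diag d A = kron (block_dim d l) 1%:M A.
Proof. by rewrite kron1l. Qed.

Lemma block_antidiagE d l (A : 'M[R]_l) :
  block_antidiag d A = kron (block_dim d l) (rev_mx (2 * d)) A.
Proof.
rewrite /block_antidiag /kron; congr castmx; apply: eq_mxblock => a b.
by rewrite !mxE permE eq_sym; case: eqP; rewrite ?scale1r ?scale0r.
Qed.

(** For an orthogonal square root of a sign, transposing is multiplying by that
sign: [A^T = A^T (A A) / eps = A / eps]. *)
Lemma orthogonal_mx_tr l (A : 'M[R]_l) eps :
  orthogonal_mx A -> eps * eps = 1 -> A *m A = eps%:M -> A^T = eps *: A.
Proof.
move=> hO eps2 A2.
rewrite -[A in RHS]mul1mx -hO -mulmxA A2 mul_mx_scalar scalerA eps2.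
by rewrite scale1r.
Qed.

End SignMatrix.

Theorem proposition3p8 (R : realType) (m r l d : nat) (A : 'I_m -> 'M[R]_l)
    (hm : (1 < m)%N) (hr : (r <= m)%N) (hl : (0 < l)%N) (hd : (0 < d)%N)
    (hO : forall i : 'I_m, orthogonal_mx (A i))
    (hA : clifford_relations r A) :
  clifford_system m r (d * l) (d * l) (block_family r d A).
Proof.
pose S := rev_mx R (2 * d); pose K := sign_mx R (2 * d) d.
pose c (i : 'I_m) := if (i < r)%N then S else 1%:M.
pose eps (i : 'I_m) : R := if (i < r)%N then -1 else 1.
have PE i : block_family r d A i = kron (block_dim d l) (c i) (A i).
  by rewrite /block_family /c block_diagE block_antidiagE; case: ifP.
have etaE i j : sign_mx R m r i j = eps i *+ (i == j) by rewrite !mxE.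
have eps2 i : eps i * eps i = 1.
  by rewrite /eps; case: ifP; rewrite ?mulrNN mulr1.
have cC i j : c i *m c j = c j *m c i.
  by rewrite /c; do 2!case: ifP => _; rewrite ?mulmx1 ?mul1mx.
have c2 i : c i *m c i = 1%:M.
  by rewrite /c; case: ifP => _; rewrite ?rev_mxK ?mulmx1.
have cT i : (c i)^T = c i.
  by rewrite /c; case: ifP => _; rewrite ?tr_rev_mx ?trmx1.
have cK i : c i *m K = eps i *: (K *m c i).
  rewrite /c /eps; case: ifP => _; last by rewrite scale1r mulmx1 mul1mx.
  by rewrite scaleN1r rev_mx_sign_mx.
have A2 i : A i *m A i = (eps i)%:M.
  have two_neq0 : 2 != 0 :> R by rewrite pnatr_eq0.
  apply: (scalerI two_neq0); rewrite scale_scalar_mx.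
  by rewrite scaler_nat mulr2n hA etaE eqxx.
have AT i : (A i)^T = eps i *: A i by apply: orthogonal_mx_tr.
split=> //.
- by rewrite muln_gt0 hd.
- by rewrite leq_pmull.
- move=> i; apply: pseudo_symP.
  rewrite PE (sign_mx_kron R d (block_dim d l)) tr_kron !mul_kron.
  rewrite cT AT cK mulmx1 mul1mx kronZ.
  by rewrite scalerA eps2 scale1r.
move=> i j; rewrite !PE !mul_kron (cC j i) -kronDr hA etaE.
case: eqVneq => [<-|_]; first by rewrite c2 kron_scalar.
by rewrite mulr0n mulr0 !raddf0 kron0r.
Qed.
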